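(* Let $b_2>0$ and $0<b_1<b_1^*:=\frac{4}{27}b_2^3$, let $m(x)=\frac{b_1}{x^8}-x-\frac{b_2}{x^2}$ for $x>0$, and let $x_l$ and $x_r$ be respectively the local minimum point and the local maximum point of $m$ on $(0,\infty)$. Put $a_i=-m(x_i)$ for $i\in\{l,r\}$. Then, for each $i\in\{r,l\}$, the point $(x_i,a_i)$ is a local saddle-node bifurcation point of the conservative system with parameter $a$ $$x'=y,\qquad y'=F(x,a):=m(x)+a\qquad (x>0).$$
   Context: When $0<b_1<b_1^*$, the function $m$ has exactly one local minimum point $x_l$ and exactly one local maximum point $x_r$ on $(0,\infty)$, and $m(x_l)<m(x_r)<0$. The equilibria of the system for parameter value $a$ are the points $(x,0)$ with $F(x,a)=0$. Local saddle-node bifurcation at $(x_i,a_i)$ means a fold (collision and disappearance) of two equilibria as $a$ crosses $a_i$: there are a neighborhood $U$ of $x_i$ in $(0,\infty)$ and $\delta>0$ such that, among equilibria $(x,0)$ with $x\in U$, the system has none for $a$ on one side of $a_i$ with $0<|a-a_i|<\delta$, exactly one (namely $(x_i,0)$) for $a=a_i$, and exactly two, one stable (a center) and one unstable (a saddle), for $a$ on the other side of $a_i$ with $0<|a-a_i|<\delta$. *)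

(* Defs.v *)
From mathcomp Require Import all_boot all_order all_algebra.
From mathcomp Require Import all_classical all_reals all_analysis.

Set Implicit Arguments.
Unset Strict Implicit.
Unset Printing Implicit Defensive.

Import Order.TTheory GRing.Theory Num.Theory.
Import numFieldNormedType.Exports.

Local Open Scope classical_set_scope.
Local Open Scope ring_scope.

Definition local_min_point (R : realType) (A : set R) (f : R -> R) (x : R) :=
  A x /\ \forall y \near within A (nbhs x), f x <= f y.

Definition local_max_point (R : realType) (A : set R) (f : R -> R) (x : R) :=
  A x /\ \forall y \near within A (nbhs x), f y <= f x.

(* Solution of p' = f p in the open phase space D. On an interval I with endpoints, continuity on I together with the equation
   in the interior gives the one-sided equation at the endpoints. *)
Definition solution (R : realType) (D : set (R * R)) (f : R * R -> R * R)
    (I : set R) (phi : R -> R * R) :=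
  [/\ {within I, continuous phi},
      forall t, I t -> D (phi t)
    & forall t, I° t -> is_derive t 1 phi (f (phi t))].

Definition equilibrium (R : realType) (D : set (R * R)) (f : R * R -> R * R)
    (e : R * R) :=
  D e /\ f e = 0.

(* Lyapunov stability. The quantification over all solution segments on
   [0, T] makes no assumption that solutions extend to all positive times;
   for a locally Lipschitz field those staying near e do. *)
Definition stable (R : realType) (D : set (R * R)) (f : R * R -> R * R)
    (e : R * R) :=
  equilibrium D f e /\
  forall eps : R, 0 < eps -> exists2 del : R, 0 < del &
    forall (T : R) (phi : R -> R * R), solution D f `[0, T] phi ->
      ball e del (phi 0) -> forall t, 0 <= t <= T -> ball e eps (phi t).

Definition unstable (R : realType) (D : set (R * R)) (f : R * R -> R * R)
    (e : R * R) :=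
  equilibrium D f e /\ ~ stable D f e.

(* Nonlinear center: a punctured neighborhood of e is filled with closed
   orbits. For a locally Lipschitz field, phi is the only solution through p. *)
Definition center (R : realType) (D : set (R * R)) (f : R * R -> R * R)
    (e : R * R) :=
  equilibrium D f e /\
  \forall p \near e, p <> e ->
    exists phi : R -> R * R,
      [/\ solution D f setT phi, phi 0 = p, (exists t, phi t <> p)
        & exists2 T : R, 0 < T & forall t, phi (t + T) = phi t].

(* Hyperbolic saddle: the linearization has one negative and one positive
   real eigenvalue. *)
Definition saddle (R : realType) (D : set (R * R)) (f : R * R -> R * R)
    (e : R * R) :=
  [/\ equilibrium D f e, differentiable f e
    & exists (l1 l2 : R) (v1 v2 : R * R),
      [/\ l1 < 0 < l2, v1 != 0 /\ 'd f e v1 = l1 *: v1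
        & v2 != 0 /\ 'd f e v2 = l2 *: v2]].

Definition equilibria_over (R : realType) (D : set (R * R))
    (f : R * R -> R * R) (U : set R) : set (R * R) :=
  [set p | equilibrium D f p /\ U p.1].

(* Local saddle-node (fold) at (x0, a0) of the family (f a)_a on the phase space
   {x > 0}. The boolean s tells on which side of a0 the two equilibria exist:
   a > a0 if s is true, a < a0 if s is false. *)
Definition local_saddle_node (R : realType) (f : R -> R * R -> R * R)
    (x0 a0 : R) :=
  let D := [set p : R * R | 0 < p.1] in
  exists (U : set R) (del : R) (s : bool),
    [/\ nbhs x0 U, U `<=` [set x | 0 < x], 0 < del,
        equilibria_over D (f a0) U = [set (x0, 0)]
      & forall a, 0 < `|a - a0| < del ->
        if (a0 < a) == s then
          exists p q : R * R,
            [/\ p <> q, equilibria_over D (f a) U = [set p; q],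
                stable D (f a) p /\ center D (f a) p
              & unstable D (f a) q /\ saddle D (f a) q]
        else equilibria_over D (f a) U = set0].

Definition m (R : realType) (b1 b2 : R) (x : R) : R :=
  b1 / x ^+ 8 - x - b2 / x ^+ 2.

Definition F (R : realType) (b1 b2 : R) (x a : R) : R := m b1 b2 x + a.

Definition conservative_system (R : realType) (b1 b2 : R) (a : R)
    (p : R * R) : R * R :=
  (p.2, F b1 b2 p.1 a).

Definition b1_star (R : realType) (b2 : R) : R := 4 / 27 * b2 ^+ 3.

(* Main.v *)
(** The field is the Newton system x' = y, y' = f x with f = m + a, whose energy
    y^2 - 2 V x (V' = f) is conserved. At a zero q of f with f' q <> 0 there is a
    C^1 coordinate G near q, increasing, with G q = 0 and G^2 = 2 |V - V q|.
    - If f' q < 0, the energy is y^2 + G^2 up to a constant: its level curves are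
      circles in the (G, y)-plane, which gives stability; on the circle of radius
      rho the angle th (G = rho sin th, y = rho cos th) obeys the positive scalar
      equation th' = G'(x), solved by a quadrature, and th + 2 pi is reached after a
      period.
    - If 0 < f' q, the curve y = G x is invariant, and x' = G x on it: solutions
      starting on it arbitrarily close to (q, 0), with x > q, leave a fixed
      neighbourhood.
    Finally m' and m'' vanish simultaneously only if b1 = b1_star b2, so that each
    extremum of m is nondegenerate and the levels of m near it are hit exactly
    twice on one side, with slopes of opposite signs, and never on the other. *)

Require Import Defs.
From mathcomp Require Import all_boot all_order all_algebra.
From mathcomp Require Import all_classical all_reals all_analysis.
From mathcomp Require Import ring lra.

Import Order.TTheory GRing.Theory Num.Theory.
Import numFieldNormedType.Exports.

Local Open Scope classical_set_scope.
Local Open Scope ring_scope.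

(** * Antiderivatives and scalar equations *)

Lemma is_derive_continuous (R : realType) (V : normedModType R) (f : R -> V)
    (x : R) (d : V) : is_derive x 1 f d -> {for x, continuous f}.
Proof. by case=> /derivable1_diffP/differentiable_continuous. Qed.

Lemma is_derive_pair (R : realType) (phi : R -> R * R) (t : R) (d : R * R) :
  is_derive t 1 phi d <->
  is_derive t 1 (fst \o phi) d.1 /\ is_derive t 1 (snd \o phi) d.2.
Proof.
have dcvg (V : normedModType R) (g : R -> V) l : is_derive t 1 g l <->
    h^-1 *: ((g \o shift t) (h *: 1) - g t) @[h --> 0^'] --> l.
  split=> [[dg <-]|c]; first exact: dg.
  by split; [apply/cvg_ex; exists l|apply: cvg_lim].
split=> [/dcvg c|[/dcvg c1 /dcvg c2]].
- have cfst : {for d, continuous (@fst R R)} by exact: cvg_fst.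
  have csnd : {for d, continuous (@snd R R)} by exact: cvg_snd.
  split; apply/dcvg.
    exact: (@cvg_comp _ _ _ _ fst _ _ _ c cfst).
  exact: (@cvg_comp _ _ _ _ snd _ _ _ c csnd).
- apply/dcvg; have -> : d = (d.1, d.2) by case: d {c1 c2}.
  exact: cvg_pair c1 c2.
Qed.

Section antiderivative.
Context {R : realType} (f : R -> R).
Hypothesis cf : continuous f.
Notation mu := (@lebesgue_measure R).

Let intf (i : interval R) (a b : R) : [set` i] `<=` `[a, b] ->
  mu.-integrable [set` i] (EFin \o f).
Proof.
move=> iab; apply: (@integrableS _ _ _ mu `[a, b]) => //.
apply: continuous_compact_integrable; first exact: segment_compact.
exact: continuous_subspaceT.
Qed.

Lemma continuous_antiderivative :
  exists P : R -> R, forall x : R, is_derive x 1 P (f x).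
Proof.
pose P x : R := if 0 <= x then \int[mu]_(t in `]0, x]) f t
                else - \int[mu]_(t in `]x, 0]) f t.
exists P => x.
(* The base point [a] lies to the left of both [0] and [x]. Near [x] the function [P] is therefore
   [Q] minus the constant [Q 0], whatever the sign of [x], and the fundamental theorem of calculus
   applies to [Q]. *)
pose a : R := - `|x| - 1.
pose Q y : R := \int[mu]_(t in `[a, y]) f t.
have ax : a < x by rewrite /a; have := ler_norm (- x); rewrite normrN; lra.
have a0 : a < 0 by rewrite /a; have := normr_ge0 x; lra.
have PQ : {near x, (Q \- cst (Q 0)) =1 P}.
  near=> y.
  have ay : a < y by near: y; exact: lt_nbhsr.
  rewrite /= /P /Q; case: ifPn => [y0|]; [|rewrite -ltNge => y0].
    by rewrite Rintegral_itvB ?bnd_simp ?(ltW a0)//; exact: (@intf _ a y).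
  rewrite -[LHS]opprB Rintegral_itvB ?bnd_simp ?(ltW ay) ?(ltW y0)//.
  exact: (@intf _ a 0).
apply: (@near_eq_is_derive R R R _ _ x 1 (f x) PQ).
have [dQ QE] := @continuous_FTC1_closed R f a x (x + 1) ltac:(lra)
  (@intf _ a (x + 1) (fun=> id)) ax (cf x).
have : is_derive x 1 Q (f x) by split; [exact: dQ|rewrite -derive1E; exact: QE].
by move=> ?; rewrite -[f x]subr0; exact: is_deriveB.
Unshelve. all: by end_near. Qed.

End antiderivative.

Lemma MVT_closed (R : realType) (f df : R -> R) (a b : R) : a < b ->
  (forall x : R, a <= x <= b -> is_derive x 1 f (df x)) ->
  exists2 c, a < c < b & f b - f a = df c * (b - a).
Proof.
move=> ab dfE; have [x|x|c] := @MVT R f df a b ab.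
- by rewrite in_itv/= => /andP[? ?]; apply: dfE; rewrite !ltW.
- apply: derivable_within_continuous => y; rewrite in_itv/= => /dfE dy.
  exact: ex_derive.
- by rewrite in_itv/=; exists c.
Qed.

(** Separation of variables for th' = g(th): [Th] is an antiderivative of 1/g and [th] its inverse.
    The bound [C] keeps the slope of [Th] above 1/C, so [Th] is onto and [th] is defined for all
    times. *)
Lemma scalar_flow (R : realType) (g : R -> R) (C : R) :
  continuous g -> (forall x, 0 < g x <= C) ->
  exists th Th : R -> R,
    [/\ cancel th Th, cancel Th th, {homo Th : x y / x < y},
        forall t : R, is_derive t 1 th (g (th t))
      & forall x : R, is_derive x 1 Th (g x)^-1].
Proof.
move=> cg gC.
have g0 x : 0 < g x by have /andP[] := gC x.
have C0 : 0 < C by have /andP[+ +] := gC 0; exact: lt_le_trans.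
have [|Th dTh] := @continuous_antiderivative R (fun x => (g x)^-1).
  by move=> x; apply: cvgV; [rewrite gt_eqF|exact: cg].
have cTh x : {for x, continuous Th} := is_derive_continuous _ _ _ _ _ (dTh x).
have MVTh x y : x < y -> (y - x) / C <= Th y - Th x.
  move=> xy; have [c _ ->] := MVT_closed R Th _ x y xy (fun z _ => dTh z).
  rewrite mulrC; apply: ler_wpM2r; first by rewrite subr_ge0 ltW.
  by rewrite lef_pV2 ?posrE//; have /andP[] := gC c.
have ltTh : {homo Th : x y / x < y}.
  move=> x y xy; rewrite -subr_gt0 (lt_le_trans _ (MVTh _ _ xy))//.
  by rewrite divr_gt0 ?subr_gt0.
have surj y : exists x, Th x = y.
  (* With slope at least 1/C, [Th] moves by at least b/C, hence by at least |y - Th 0|, on each side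
     of 0. So [y] lies between [Th (- b)] and [Th b]; the summand 1 makes [b] positive. *)
  pose b := C * `|y - Th 0| + 1.
  have b0 : 0 < b by rewrite ltr_wpDl// mulr_ge0// ltW.
  have bC : `|y - Th 0| <= b / C.
    by rewrite ler_pdivlMr// mulrC lerDl.
  have Tb : y <= Th b.
    have := MVTh _ _ b0; have := ler_norm (y - Th 0); rewrite subr0; lra.
  have TNb : Th (- b) <= y.
    have Nb0 : - b < 0 by rewrite oppr_lt0.
    have := MVTh _ _ Nb0; have := ler_norm (- (y - Th 0)).
    by rewrite normrN sub0r opprK; lra.
  have [||x _ <-] := @IVT R Th (- b) b y _ (continuous_subspaceT cTh).
  - by lra.
  - by rewrite ge_min TNb le_max Tb orbT.
  - by exists x.
pose th y := projT1 (cid (surj y)).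
have thK : cancel th Th by move=> y; rewrite /th; case: cid.
have ThK : cancel Th th.
  move=> x; apply/eqP; rewrite eq_le !leNgt; apply/andP; split.
    by apply/negP => /ltTh; rewrite thK ltxx.
  by apply/negP => /ltTh; rewrite thK ltxx.
exists th, Th; split => // t.
have : is_derive (Th (th t)) 1 th (g (th t))^-1^-1; last by rewrite thK invrK.
apply: is_derive_inverse.
- by near=> x; exact: ThK.
- by near=> x; exact: cTh.
- by rewrite invr_neq0// gt_eqF.
Unshelve. all: by end_near. Qed.

(** * The square root of the potential *)

Lemma near_neq (R : realType) (x y : R) : x != y -> \forall z \near x, z != y.
Proof. by move=> xy; apply: (@open_nbhs_nbhs R x); split; [exact: open_neq|]. Qed.

(** To leading order V - V q is k (z - q)^2 / 2, so 2 (V - V q) = (z - q)^2 K with K positive near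
    q, and G = (z - q) sqrt K is its signed square root. Writing f = h (z - q), the relation G g = f
    forces g = h / sqrt K. Continuity of K at q comes from K z = h c for some c no farther from q
    than z. *)
Lemma energy_coordinate (R : realType) (V f : R -> R) (q k r0 : R) :
  0 < r0 ->
  (forall x : R, `|x - q| < r0 -> is_derive x 1 V (f x)) ->
  (forall x : R, `|x - q| < r0 -> {for x, continuous f}) ->
  f q = 0 -> is_derive q 1 f k -> 0 < k ->
  exists (r : R) (G g : R -> R),
    [/\ 0 < r, r <= r0, G q = 0
      & forall x : R, `|x - q| < r ->
        [/\ is_derive x 1 G (g x), 0 < g x, {for x, continuous g},
            G x * g x = f x & G x ^+ 2 = 2 * (V x - V q)]].
Proof.
move=> r00 dV cf fq /is_derive1_caratheodory[h [hE ch hq]] k0.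
have {}hE z : f z = h z * (z - q) by rewrite -hE fq subr0.
(* K extends 2 (V - V q) / (z - q)^2 by its limit k at q, and G = (z - q) sqrt K. *)
pose K z := if z == q then k else 2 * (V z - V q) / (z - q) ^+ 2.
have KE z : z != q -> K z = 2 * (V z - V q) / (z - q) ^+ 2.
  by rewrite /K => /negbTE ->.
have Kq : K q = k by rewrite /K eqxx.
have Kh z : `|z - q| < r0 -> exists2 c, `|c - q| <= `|z - q| & K z = h c.
  move=> zr; have [->|zq] := eqVneq z q.
    by exists q => //; rewrite Kq hq.
  (* Rolle: Z has a vanishing derivative between q and z. *)
  pose s := (V z - V q) / (z - q) ^+ 2.
  pose Z := V - s *: ((id - cst q) ^+ 2).
  have zq0 : z - q != 0 by rewrite subr_eq0.
  have Zz : Z z = Z q.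
    rewrite /Z !fctE /s /= subrr expr0n /= scaler0 subr0.
    by rewrite /GRing.scale /= divfK ?expf_neq0//; ring.
  have dZ x : `|x - q| < r0 -> is_derive x 1 Z (f x - 2 * s * (x - q)).
    move=> /dV dVx; apply: is_derive_eq.
    by rewrite /GRing.scale /= !fctE /= expr1 subr0; ring.
  have [a [b [ab Zab abq abz]]] : exists a b, [/\ a < b, Z b - Z a = 0,
      (forall c, a <= c <= b -> `|c - q| <= `|z - q|)
      & (forall c, a < c < b -> c != q)].
    have [zLq|qLz|zE] := ltgtP z q; last by rewrite zE eqxx in zq.
      exists z, q; split=> //; rewrite ?Zz ?subrr// => c /andP[c1 c2].
        by rewrite !ler0_norm; lra.
      by rewrite lt_eqF.
    exists q, z; split=> //; rewrite ?Zz ?subrr// => c /andP[c1 c2].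
      by rewrite !ger0_norm; lra.
    by rewrite gt_eqF.
  have [c cab] := MVT_closed R Z _ a b ab (fun x xab =>
    dZ x (le_lt_trans (abq x xab) zr)).
  have cq := abq c ltac:(by case/andP: cab => *; rewrite !ltW).
  have cq0 : c - q != 0 by rewrite subr_eq0 abz.
  rewrite Zab => /esym/eqP; rewrite mulf_eq0 [b - a == 0]subr_eq0.
  rewrite (gt_eqF ab) orbF hE -mulrBl mulf_eq0 (negbTE cq0) orbF subr_eq0.
  by move=> /eqP hc; exists c => //; rewrite KE// hc /s mulrA.
have near_h (e : R) : 0 < e -> exists2 d : R, 0 < d &
    forall z, `|z - q| < d -> `|h z - k| < e.
  move=> e0; have : h @ q --> k by rewrite -hq.
  move=> /cvgrPdist_lt /(_ e e0).
  move=> [d /= d0 dP]; exists d => // z zd; rewrite distrC; apply: dP.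
  by rewrite /= distrC.
have cK : {for q, continuous K}.
  apply/cvgrPdist_lt => e e0; rewrite Kq.
  have [d d0 dP] := near_h e e0; near=> z.
  have [|c cz ->] := Kh z.
    by rewrite distrC; near: z; exact: cvgr_dist_lt.
  rewrite distrC; apply: dP; apply: le_lt_trans cz _.
  by rewrite distrC; near: z; exact: cvgr_dist_lt.
(* With tolerance [k] itself, |h - k| < k makes [h], and with it [K], positive. *)
have [r1 r10 hr1] := near_h k k0.
pose r := Num.min r0 r1.
have h0 z : `|z - q| < r -> 0 < h z.
  rewrite lt_min => /andP[_ /hr1]; rewrite ltr_norml; lra.
have rr0 z : `|z - q| < r -> `|z - q| < r0 by rewrite lt_min => /andP[].
have K0 z : `|z - q| < r -> 0 < K z.
  move=> zr; have [c cz ->] := Kh z (rr0 z zr).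
  by apply: h0; exact: le_lt_trans zr.
have dK z : `|z - q| < r -> z != q ->
    is_derive z 1 K (2 * (h z - K z) / (z - q)).
  move=> zr zq; have zq0 : z - q != 0 by rewrite subr_eq0.
  have dVz := dV z (rr0 z zr).
  pose K1 : R -> R :=
    (2 *: (V - cst (V q))) * (fun y => (((id - cst q) ^+ 2) y)^-1).
  have nK : {near z, K1 =1 K}.
    near=> y; rewrite KE; last by near: y; exact: near_neq.
    by rewrite /K1 !fctE.
  apply: (@near_eq_is_derive R R R _ _ z 1 _ nK).
  have sq0 : ((id - cst q) ^+ 2) z != 0 by rewrite !fctE /= expf_neq0.
  apply: is_derive_eq; rewrite KE// !fctE /= hE /GRing.scale /=.
  by field.
exists r, (fun z => (z - q) * Num.sqrt (K z)), (fun z => h z / Num.sqrt (K z)).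
split=> [|||z zr]; rewrite ?lt_min ?r00//; first by rewrite ge_min lexx.
  by rewrite subrr mul0r.
have sK0 : 0 < Num.sqrt (K z) by rewrite sqrtr_gt0 K0.
have sKn : Num.sqrt (K z) != 0 by rewrite gt_eqF.
have sKK : Num.sqrt (K z) ^+ 2 = K z by rewrite sqr_sqrtr// ltW// K0.
have cKz : {for z, continuous K}.
  have [->//|zq] := eqVneq z q.
  exact: is_derive_continuous (dK z zr zq).
have chz : {for z, continuous h}.
  have [->//|zq] := eqVneq z q.
  have nh : {near z, (fun y => f y / (y - q)) =1 h}.
    near=> y; rewrite hE mulfK// subr_eq0; near: y; exact: near_neq.
  have : h @ z --> f z / (z - q); last by rewrite (nbhs_singleton nh).
  apply: cvg_trans (near_eq_cvg nh) _.
  apply: cvgM; first exact: cf (rr0 z zr).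
  apply: cvgV; first by rewrite subr_eq0.
  by apply: cvgB; [exact: cvg_id|exact: cvg_cst].
split.
(* At [q] the quotient G z / (z - q) is sqrt K, which is continuous there, so Caratheodory's
   criterion gives the derivative; elsewhere the product rule applies. *)
- have [zq|zq] := eqVneq z q.
    apply/is_derive1_caratheodory; exists (fun y => Num.sqrt (K y)); split.
    + by move=> y; rewrite zq subrr mul0r subr0 mulrC.
    + by apply: continuous_comp => //; exact: sqrt_continuous.
    + by apply: (mulIf sKn); rewrite divfK// -expr2 sKK zq Kq hq.
  have dKz := dK z zr zq; have dS := is_derive1_sqrt (K0 z zr).
  have : is_derive z 1 ((id - cst q) * (Num.sqrt \o K)) (h z / Num.sqrt (K z)).
    apply: is_derive_eq; rewrite !fctE /GRing.scale /=.
    have zq0 : z - q != 0 by rewrite subr_eq0.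
    move: sKK sKn; set s := Num.sqrt _ => <- s0.
    by field; rewrite zq0 s0.
  by [].
- by rewrite divr_gt0 ?h0.
- apply: continuousM => //; apply: continuousV => //.
  by apply: continuous_comp => //; exact: sqrt_continuous.
- by rewrite [RHS]hE; field.
- rewrite exprMn sKK; have [->|zq] := eqVneq z q.
    by rewrite !subrr expr0n /= !mul0r mulr0.
  by rewrite KE// mulrC divfK// expf_neq0// subr_eq0.
Unshelve. all: by end_near. Qed.

(** * Energy and stability *)

Definition newton (R : realType) (f : R -> R) (p : R * R) : R * R :=
  (p.2, f p.1).

Definition half_plane (R : realType) : set (R * R) := [set p | 0 < p.1].

(** Twice the mechanical energy. Since V' = f, it is -V that is the potential energy in the usual
    sign convention. *)
Definition energy (R : realType) (V : R -> R) (p : R * R) : R :=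
  p.2 ^+ 2 - 2 * V p.1.

Lemma energy_continuous (R : realType) (V : R -> R) (p : R * R) :
  {for p.1, continuous V} -> {for p, continuous (energy R V)}.
Proof.
move=> cV.
have c1 : {for p, continuous (@fst R R)} by exact: cvg_fst.
have c2 : {for p, continuous (@snd R R)} by exact: cvg_snd.
apply: cvgB; first exact: (cvgM c2 c2).
apply: cvgM; first exact: cvg_cst.
exact: (continuous_comp c1 cV).
Qed.

(** The derivative along a solution is 2 y f - 2 f y = 0. It is computed only in the interior of the
    time interval; continuity up to the endpoints lets the mean value theorem conclude. *)
Lemma energy_conservation (R : realType) (V f : R -> R) (T : R)
    (phi : R -> R * R) :
  (forall x : R, 0 < x -> is_derive x 1 V (f x)) ->
  solution (@half_plane R) (newton R f) `[0, T] phi ->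
  forall t, 0 <= t <= T -> energy R V (phi t) = energy R V (phi 0).
Proof.
move=> dV [cphi Dphi dphi] t /andP[t0 tT].
have sub : `[0, t] `<=` `[0, T] by apply: subset_itvl; rewrite bnd_simp.
have [s s0t||c _] := @MVT_segment R (energy R V \o phi) (cst 0) 0 t t0; last first.
- by rewrite mul0r => /eqP; rewrite subr_eq0 => /eqP.
- apply: within_continuous_comp; last exact: continuous_subspaceW sub cphi.
  move=> _ /set_mem[s /sub/Dphi s0 <-]; apply: energy_continuous.
  exact: is_derive_continuous (dV _ s0).
- have s0T : `[0, T]° s.
    rewrite interior_itv_bnd /= in_itv/=.
    by move: s0t; rewrite in_itv/= => /andP[-> /lt_le_trans->].
  have := dphi s s0T; rewrite is_derive_pair /newton /= => -[d1 d2].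
  have dVs := dV _ (Dphi s (interior_subset s0T)).
  have : is_derive s 1 ((snd \o phi) ^+ 2 - 2 *: (V \o (fst \o phi))) 0.
    by apply: is_derive_eq; rewrite !fctE /GRing.scale /= expr1; ring.
  by [].
Qed.

Lemma increasing_of_derive_gt0 (R : realType) (G g : R -> R) (q r : R) :
  (forall x : R, `|x - q| < r -> is_derive x 1 G (g x)) ->
  (forall x : R, `|x - q| < r -> 0 < g x) ->
  forall x y, `|x - q| < r -> `|y - q| < r -> x < y -> G x < G y.
Proof.
move=> dG g0 x y xr yr xy.
have ball_xy z : x <= z <= y -> `|z - q| < r.
  by move: xr yr; rewrite !ltr_norml; lra.
have [c cxy GE] := MVT_closed R G g x y xy (fun z zxy => dG z (ball_xy z zxy)).
rewrite -subr_gt0 GE mulr_gt0 ?subr_gt0// g0// ball_xy//.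
by case/andP: cxy => *; rewrite !ltW.
Qed.

Section equilibrium_of_newton.
Context (R : realType) (V f : R -> R) (q k : R).
Hypothesis q0 : 0 < q.
Hypothesis dV : forall x : R, 0 < x -> is_derive x 1 V (f x).
Hypothesis cf : forall x : R, 0 < x -> {for x, continuous f}.
Hypothesis fq : f q = 0.
Hypothesis dfq : is_derive q 1 f k.

Lemma newton_equilibrium : equilibrium (@half_plane R) (newton R f) (q, 0).
Proof. by split => //; rewrite /newton /= fq. Qed.

Let pos_near x : `|x - q| < q -> 0 < x.
Proof. by rewrite ltr_norml; lra. Qed.

(** This is [energy_coordinate] for -V and -f, whose slope at [q] is -k > 0. *)
Lemma center_coordinate : k < 0 -> exists (r : R) (G g : R -> R),
  [/\ 0 < r, r <= q, G q = 0,
      forall x y, `|x - q| < r -> `|y - q| < r -> x < y -> G x < G y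
    & forall x : R, `|x - q| < r ->
      [/\ is_derive x 1 G (g x), 0 < g x, {for x, continuous g},
          G x * g x = - f x & G x ^+ 2 = 2 * (V q - V x)]].
Proof.
move=> k0.
have [||||r [G [g [r0 rq Gq Gg]]]] :=
    @energy_coordinate R (- V) (- f) q (- k) q q0.
- by move=> x /pos_near/dV ?; exact: is_deriveN.
- by move=> x /pos_near/cf; exact: continuousN.
- by rewrite fctE fq oppr0.
- by rewrite oppr_gt0.
exists r, G, g; split=> //.
  by apply: (@increasing_of_derive_gt0 R G g q r) => x /Gg[].
by move=> x /Gg[? ? ? GgE GE]; split=> //; rewrite GE !fctE; ring.
Qed.

(** The conserved quantity E = y^2 + G^2 has a strict minimum at the equilibrium. A solution
    starting below a small level of E is trapped between the lines x = q - rho and x = q + rho, and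
    E then bounds y as well. *)
Lemma stable_of_derive_lt0 :
  k < 0 -> stable (@half_plane R) (newton R f) (q, 0).
Proof.
move=> k0; split; first exact: newton_equilibrium.
move=> eps eps0.
have [r [G [g [r0 rq Gq Ginc Gg]]]] := center_coordinate k0.
pose rho := Num.min eps r / 2.
have rho0 : 0 < rho by rewrite divr_gt0// lt_min eps0 r0.
have [rho_eps rho_r] : rho < eps /\ rho < r.
  have : rho < Num.min eps r by rewrite /rho; move: rho0; rewrite /rho; lra.
  by rewrite lt_min => /andP.
pose E p := energy R V p + 2 * V q.
have Eq x y : `|x - q| < r -> E (x, y) = y ^+ 2 + G x ^+ 2.
  by move=> /Gg[_ _ _ _ ->]; rewrite /E /energy /=; ring.
have qq : `|q - q| < r by rewrite subrr normr0.
have qrho : `|q + rho - q| < r by rewrite addrC addKr gtr0_norm.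
have qNrho : `|q - rho - q| < r by rewrite addrC addKr normrN gtr0_norm.
(* On the lines x = q - rho and x = q + rho, E is at least G^2, hence at least [mu]. The entry rho^2
   makes E < mu imply |y| < rho. *)
pose mu := Num.min (rho ^+ 2) (Num.min (G (q + rho) ^+ 2) (G (q - rho) ^+ 2)).
have mu0 : 0 < mu.
  rewrite !lt_min exprn_gt0//=; apply/andP; split.
    by rewrite exprn_gt0// -Gq Ginc// ltrDl.
  by rewrite exprn_even_gt0//= -Gq lt_eqF// Ginc// gtrBl.
have cE : {for (q, 0), continuous E}.
  apply: cvgD; last exact: cvg_cst.
  by apply: energy_continuous; exact: is_derive_continuous (dV q q0).
have [del del0 delP] : exists2 del : R, 0 < del & forall p : R * R,
    ball (q, 0) del p -> E p < mu /\ `|p.1 - q| < rho.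
  have nE : \forall p \near (q, 0), E p < mu /\ `|p.1 - q| < rho.
    have EqE : E (q, 0) = 0 by rewrite Eq// Gq expr0n addr0.
    have c1 : @fst R R @ (q, 0) --> q by exact: cvg_fst.
    near=> p; split.
      by near: p; apply: (cvgr_lt _ cE); rewrite EqE.
    by rewrite distrC; near: p; apply: cvgr_dist_lt.
  by have /nbhs_ballP[del /= del0 delP] := nE; exists del.
exists del => // T phi sphi phi0 t tT.
have [Ephi0 phi0rho] := delP _ phi0.
have Econst s : 0 <= s <= T -> E (phi s) < mu.
  by move=> sT; rewrite /E (energy_conservation R V f T phi dV sphi s sT).
(* To leave the strip, the solution would by the intermediate value theorem meet one of the lines |x
   - q| = rho at some time, where E is not below [mu]. *)
have phi_rho : `|(phi t).1 - q| < rho.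
  rewrite ltNge; apply/negP => rho_le.
  have /andP[t0 tT'] := tT.
  have sub : `[0, t] `<=` `[0, T] by apply: subset_itvl; rewrite bnd_simp.
  have cd : {within `[0, t], continuous (fun s => `|(phi s).1 - q|)}.
    apply: (@within_continuous_comp _ _ _ _ phi (fun p : R * R => `|p.1 - q|)).
      move=> p _.
      apply: (@continuous_comp _ _ _ (fun p : R * R => p.1 - q) Num.norm);
        last exact: norm_continuous.
      by apply: cvgB; [exact: cvg_fst|exact: cvg_cst].
    by case: sphi => cphi _ _; exact: continuous_subspaceW sub cphi.
  have [|s] := IVT t0 cd (v := rho).
    by rewrite ge_min (ltW phi0rho) le_max rho_le orbT.
  rewrite in_itv/= => /andP[s0 st] srho.
  have sT : 0 <= s <= T by rewrite s0 (le_trans st).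
  have := Econst s sT; have sr : `|(phi s).1 - q| < r by rewrite srho.
  rewrite (surjective_pairing (phi s)) Eq// !lt_min => /and3P[_ h1 h2].
  have y0 := sqr_ge0 (phi s).2.
  have [e|e] : (phi s).1 = q + rho \/ (phi s).1 = q - rho.
    by move: srho; case: ger0P => _ ?; [left|right]; lra.
  - by move: h1; rewrite e; lra.
  - by move: h2; rewrite e; lra.
have := Econst t tT; rewrite (surjective_pairing (phi t)) Eq; last first.
  exact: lt_trans rho_r.
rewrite !lt_min => /andP[h _]; split; rewrite -ball_normE /ball_ /= distrC.
  exact: lt_trans rho_eps.
apply: lt_trans rho_eps; rewrite subr0 -(@ltr_pXn2r _ 2)// ?nnegrE ?ltW//.
by rewrite real_normK ?num_real//; have := sqr_ge0 (G (phi t).1); lra.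
Unshelve. all: by end_near. Qed.

End equilibrium_of_newton.

(** * Periodic orbits *)

Lemma near_dist_lt (R : realType) (x q r : R) :
  `|x - q| < r -> \forall y \near x, `|y - q| < r.
Proof.
apply: (@cvgr_lt R R (nbhs x) _ (fun y => `|y - q|) `|x - q|).
by apply: cvg_norm; apply: cvgB; [exact: cvg_id|exact: cvg_cst].
Qed.

Lemma increasing_local_inverse (R : realType) (G g : R -> R) (q r : R) :
  0 < r -> G q = 0 ->
  (forall x y, `|x - q| < r -> `|y - q| < r -> x < y -> G x < G y) ->
  (forall x : R, `|x - q| < r -> is_derive x 1 G (g x) /\ 0 < g x) ->
  exists (sg : R) (X : R -> R), [/\ 0 < sg,
    forall s : R, `|s| < sg ->
      [/\ `|X s - q| < r, G (X s) = s & is_derive s 1 X (g (X s))^-1]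
    & forall x, `|x - q| < r -> X (G x) = x].
Proof.
move=> r0 Gq Ginc dG.
(* The default [q] is taken only where [s] is not a value of [G] on the ball. *)
pose X s := xget q [set x | `|x - q| < r /\ G x = s].
have XK x : `|x - q| < r -> X (G x) = x.
  move=> xr; rewrite /X; case: xgetP => [y _ [yr Gyx]|/(_ x)/=]; last first.
    by case.
  have [yx|xy|//] := ltgtP y x.
    by have := Ginc _ _ yr xr yx; rewrite Gyx ltxx.
  by have := Ginc _ _ xr yr xy; rewrite Gyx ltxx.
pose rho := r / 2.
have qq : `|q - q| < r by rewrite subrr normr0.
have near_q x : q - rho <= x <= q + rho -> `|x - q| < r.
  by rewrite /rho ltr_norml; lra.
have qrho : `|q + rho - q| < r by apply: near_q; rewrite /rho; lra.
have qNrho : `|q - rho - q| < r by apply: near_q; rewrite /rho; lra.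
(* The radius is such that every |s| < sg lies between the values of [G] at the ends of a closed
   segment inside the ball, where the intermediate value theorem applies. *)
exists (Num.min (- G (q - rho)) (G (q + rho))), X; split=> //.
  by rewrite lt_min oppr_gt0 -Gq !Ginc// /rho; lra.
move=> s; rewrite lt_min => /andP[s1 s2].
have cG : {within `[q - rho, q + rho], continuous G}.
  apply: derivable_within_continuous => x; rewrite in_itv/= => /near_q/dG[dGx _].
  exact: ex_derive.
have rr : q - rho <= q + rho by rewrite /rho; lra.
have [|x] := IVT rr cG (v := s).
  rewrite ge_min le_max; apply/andP; split; apply/orP.
    by left; move: s1; rewrite ltr_norml; lra.
  by right; move: s2; rewrite ltr_norml; lra.
rewrite in_itv/= => /near_q xr <-; rewrite XK//; split=> //.
have [dGx gx] := dG x xr.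
apply: is_derive_inverse; last by rewrite gt_eqF.
- by near=> y; apply: XK; near: y; exact: near_dist_lt.
- near=> y; apply: (@is_derive_continuous R R G y (g y)).
  by apply: (dG y _).1; near: y; exact: near_dist_lt.
Unshelve. all: by end_near. Qed.

Lemma polar_angle (R : realType) (rho u v : R) : 0 < rho ->
  u ^+ 2 + v ^+ 2 = rho ^+ 2 ->
  exists th : R, u = rho * sin th /\ v = rho * cos th.
Proof.
move=> rho0 uv.
have rho_neq0 : rho != 0 by rewrite gt_eqF.
have vrho : (v / rho) ^+ 2 = 1 - (u / rho) ^+ 2.
  by rewrite !expr_div_n; apply: (mulIf (expf_neq0 2 rho_neq0));
     rewrite mulrBl !divfK ?expf_neq0// -uv; ring.
have c1 : -1 <= v / rho <= 1.
  rewrite -ler_norml -(@ler_pXn2r _ 2)// ?nnegrE// real_normK ?num_real//.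
  by rewrite vrho expr1n; have := sqr_ge0 (u / rho); lra.
have sE : sin (acos (v / rho)) = `|u / rho|.
  by rewrite sin_acos// vrho subKr sqrtr_sqr.
(* The arccosine has the right cosine and a nonnegative sine, so the sign of [u] decides between it
   and its opposite. *)
have [u0|u0] := leP 0 (u / rho).
  exists (acos (v / rho)); rewrite sE acosK// ger0_norm//.
  by rewrite !(mulrC rho) !divfK.
exists (- acos (v / rho)); rewrite sinN cosN sE acosK// ltr0_norm// opprK.
by rewrite !(mulrC rho) !divfK.
Qed.

(** With G x = rho sin th, y = rho cos th and th' = g x, one gets x' = th' rho cos th / g = y and y'
    = - rho sin th g = - G g = f. So the angular equation alone produces the orbit, and
    [scalar_flow] solves it. *)
Lemma center_of_derive_lt0 (R : realType) (V f : R -> R) (q k : R) : 0 < q ->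
  (forall x : R, 0 < x -> is_derive x 1 V (f x)) ->
  (forall x : R, 0 < x -> {for x, continuous f}) ->
  f q = 0 -> is_derive q 1 f k -> k < 0 ->
  Defs.center (@half_plane R) (newton R f) (q, 0).
Proof.
move=> q0 dV cf fq dfq k0.
have [r [G [g [r0 rq Gq Ginc Gg]]]] :=
  center_coordinate R V f q k q0 dV cf fq dfq k0.
have dG x : `|x - q| < r -> is_derive x 1 G (g x) /\ 0 < g x by case/Gg.
have [sg [X [sg0 XP XK]]] := increasing_local_inverse R G g q r r0 Gq Ginc dG.
split; first exact: newton_equilibrium.
have cGq : G @ q --> 0.
  rewrite -Gq; apply: (@is_derive_continuous R R G q (g q)).
  by apply: (dG q _).1; rewrite subrr normr0.
have c1 : @fst R R @ (q, 0) --> q by exact: cvg_fst.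
have c2 : @snd R R @ (q, 0) --> 0 by exact: cvg_snd.
have cG1 : (G \o fst) @ ((q, 0) : R * R) --> 0 by exact: (cvg_comp _ _ c1 cGq).
(* Bounding |G| and |y| by sg/2 gives rho^2 < sg^2 / 2, so the whole circle of radius rho stays
   where the inverse [X] of [G] is defined. *)
have sg20 : 0 < sg / 2 by rewrite divr_gt0.
have near1 := cvgr0_norm_lt _ cG1 _ sg20.
have near2 := cvgr0_norm_lt _ c2 _ sg20.
near=> p => pe.
have p1r : `|p.1 - q| < r.
  by rewrite distrC; near: p; exact: cvgr_dist_lt.
have Gp1 : `|G p.1| < sg / 2.
  by near: p; exact: near1.
have p2 : `|p.2| < sg / 2.
  by near: p; exact: near2.
pose rho := Num.sqrt (G p.1 ^+ 2 + p.2 ^+ 2).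
have rho2 : G p.1 ^+ 2 + p.2 ^+ 2 = rho ^+ 2.
  by rewrite sqr_sqrtr// addr_ge0 ?sqr_ge0.
have rho0 : 0 < rho.
  rewrite sqrtr_gt0 lt0r addr_ge0 ?sqr_ge0// andbT paddr_eq0 ?sqr_ge0//.
  rewrite !sqrf_eq0; apply/negP => /andP[/eqP G0 /eqP p20]; apply: pe.
  rewrite (surjective_pairing p) p20; congr (_, _).
  by rewrite -(XK _ p1r) G0 -Gq XK// subrr normr0.
have rho_sg : rho < sg.
  rewrite -(@ltr_pXn2r _ 2)// ?nnegrE ?ltW// -rho2.
  have sq z : `|z| < sg / 2 -> z ^+ 2 < (sg / 2) ^+ 2.
    move=> zs; rewrite -real_normK ?num_real//.
    by rewrite ltr_pXn2r// nnegrE ltW.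
  move: (sq _ Gp1) (sq _ p2).
  by rewrite expr_div_n; have := exprn_gt0 2 sg0; lra.
have [th0 [Gth pth]] := polar_angle R rho (G p.1) p.2 rho0 rho2.
have sin_sg x : `|rho * sin x| <= rho.
  by rewrite normrM gtr0_norm// ger_pMr// sin_max.
pose w s := g (X s).
have cw s : `|s| < sg -> {for s, continuous w}.
  move=> /XP[Xr _ dX]; apply: continuous_comp.
    exact: is_derive_continuous dX.
  by case: (Gg _ Xr).
(* The maximum of the angular speed on the compact range of rho sin th is the upper bound that
   [scalar_flow] asks for. *)
have [||C _ wC] := @EVT_max R w (- rho) rho.
- by rewrite ge0_cp// ltW.
- apply: continuous_in_subspaceT => s /set_mem/=; rewrite in_itv/= => srho.
  by apply: cw; rewrite (le_lt_trans _ rho_sg)// ler_norml.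
have dS (x : R) : is_derive x 1 (fun y => rho * sin y) (rho * cos x).
  by apply: is_derive_eq; rewrite /GRing.scale /=; ring.
have [||th [Th [thK ThK ltTh dth dTh]]] :=
    @scalar_flow R (fun x => w (rho * sin x)) (w C).
- move=> x; apply: (@continuous_comp _ _ _ (fun x => rho * sin x) w).
    exact: is_derive_continuous (dS x).
  by apply: cw; exact: le_lt_trans (sin_sg x) rho_sg.
- move=> x; rewrite wC ?andbT; last by rewrite in_itv/= -ler_norml sin_sg.
  have [Xr _ _] := XP _ (le_lt_trans (sin_sg x) rho_sg).
  by have [] := Gg _ Xr.
pose t0 := Th th0.
pose phi t := (X (rho * sin (th (t + t0))), rho * cos (th (t + t0))).
have phi0 : phi 0 = p.
  by rewrite /phi add0r /t0 ThK -Gth -pth XK// -surjective_pairing.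
have dphi (t : R) : is_derive t 1 phi (newton R f (phi t)).
  have dtht : is_derive t 1 (fun t => th (t + t0)) (w (rho * sin (th (t + t0)))).
    have ds := is_derive_shift t 1 t0.
    have := @is_derive1_comp R th (shift t0) t _ _ (dth (t + t0)) ds.
    by rewrite mulr1.
  have [Xr GX dX] := XP _ (le_lt_trans (sin_sg (th (t + t0))) rho_sg).
  have [_ gX _ GgE _] := Gg _ Xr.
  apply/is_derive_pair; rewrite /newton /=; split.
    have dc := @is_derive1_comp R (fun y => rho * sin y) (fun t => th (t + t0)) t
      _ _ (dS (th (t + t0))) dtht.
    have := @is_derive1_comp R X _ t _ _ dX dc.
    by rewrite /w mulrC mulfK// gt_eqF.
  have dc (x : R) : is_derive x 1 (fun y => rho * cos y) (- (rho * sin x)).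
    by apply: is_derive_eq; rewrite /GRing.scale /=; ring.
  have := @is_derive1_comp R (fun y => rho * cos y) (fun t => th (t + t0)) t
    _ _ (dc (th (t + t0))) dtht.
  by rewrite /w mulNr -{1}GX GgE opprK.
exists phi; split => //.
- split=> [|t _|t _] //.
    by apply: continuous_subspaceT => t; exact: is_derive_continuous (dphi t).
  have [Xr _ _] := XP _ (le_lt_trans (sin_sg (th (t + t0))) rho_sg).
  by move: Xr; rewrite /half_plane /= ltr_norml; lra.
(* After half a turn (G, y) has become (-G, -y). Equality with [p] would force both to vanish,
   against rho > 0. *)
- exists (Th (th0 + pi) - t0); rewrite /phi subrK ThK sinDpi cosDpi => pE.
  have : rho ^+ 2 = 0; last by apply/eqP; rewrite gt_eqF// exprn_gt0.
  have [_ GX _] := XP _ (le_lt_trans (sin_sg (th0 + pi)) rho_sg).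
  have e2 : p.2 = 0.
    have pN : rho * - cos th0 = p.2 := congr1 snd pE.
    by move: pN; rewrite mulrN -pth; lra.
  have e1 : G p.1 = 0.
    have X1 : X (rho * - sin th0) = p.1 := congr1 fst pE.
    move: GX; rewrite sinDpi X1 mulrN -Gth; lra.
  by rewrite -rho2 e1 e2 expr0n addr0.
(* The time of a full turn does not depend on the starting angle: the derivative of [Th] is 2 pi
   periodic, so the difference [D] below is constant, and [T] is its value at 0. *)
pose T := Th (0 + pi *+ 2) - Th 0.
have ThT x : Th (x + pi *+ 2) = Th x + T.
  pose D x := Th (x + pi *+ 2) - Th x.
  have dD (y : R) : is_derive y 1 D 0.
    have ds := is_derive_shift y 1 (pi *+ 2).
    have d2 := @is_derive1_comp R Th (shift (pi *+ 2)) y _ _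
      (dTh (y + pi *+ 2)) ds.
    have d1 := dTh y.
    rewrite -(subrr (w (rho * sin y))^-1) -{1}sinD2pi -[X in X - _]mulr1.
    exact: is_deriveB.
  have -> : T = D x by exact: is_derive_0_is_cst dD.
  by rewrite /D; ring.
exists T; first by rewrite subr_gt0 ltTh// add0r mulrn_wgt0 ?pi_gt0.
move=> t; have thT : th (t + T + t0) = th (t + t0) + pi *+ 2.
  by apply: (can_inj ThK); rewrite ThT !thK addrAC.
by rewrite /phi thT sinD2pi cosD2pi.
Unshelve. all: by end_near. Qed.

(** * Saddles *)

(** On the curve y = G x the scalar equation x' = G x yields a solution of the system, because y' =
    g G = f. Since G > 0 to the right of [q], the solution started at any x0 in (q, b) reaches
    [b]. *)
Lemma unstable_of_derive_gt0 (R : realType) (V f : R -> R) (q k : R) : 0 < q ->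
  (forall x : R, 0 < x -> is_derive x 1 V (f x)) ->
  (forall x : R, 0 < x -> {for x, continuous f}) ->
  f q = 0 -> is_derive q 1 f k -> 0 < k ->
  unstable (@half_plane R) (newton R f) (q, 0).
Proof.
move=> q0 dV cf fq dfq k0; split; first exact: newton_equilibrium.
have pos_near x : `|x - q| < q -> 0 < x by rewrite ltr_norml; lra.
have [r [G [g [r0 rq Gq Gg]]]] := @energy_coordinate R V f q k q q0
  (fun x xq => dV x (pos_near x xq)) (fun x xq => cf x (pos_near x xq)) fq dfq k0.
have dG x : `|x - q| < r -> is_derive x 1 G (g x) by case/Gg.
have g0 x : `|x - q| < r -> 0 < g x by case/Gg.
have Ginc := increasing_of_derive_gt0 R G g q r dG g0.
have cG x : `|x - q| < r -> {for x, continuous G}.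
  by move=> /dG; exact: is_derive_continuous.
have qq : `|q - q| < r by rewrite subrr normr0.
pose b := q + r / 2.
have near_q x : q <= x <= b -> `|x - q| < r.
  by rewrite /b ltr_norml; lra.
have r20 : 0 < r / 2 by rewrite divr_gt0.
(* Stability is tested with the radius r/2, which is exactly the distance from [b] to [q]: arriving
   at [b] contradicts the open ball. *)
move=> [_ /(_ _ r20)[del del0 delP]].
have [x0 [x0q x0b x0del Gx0del]] :
    exists x0, [/\ q < x0, x0 < b, `|q - x0| < del & `|G x0| < del].
  have cGq : G @ q^'+ --> 0.
    by apply: cvg_at_right_filter; rewrite -Gq; exact: cG.
  near q^'+ => x0; exists x0; split.
  - by [].
  - by near: x0; apply: nbhs_right_lt; rewrite /b ltrDl.
  - near: x0; apply: (@cvgr_dist_lt _ _ _ q^'+ _ id) => //.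
    exact: cvg_at_right_filter.
  - by near: x0; exact: (cvgr0_norm_lt _ cGq).
(* Clamping x to [x0, b] makes the equation x' = G x global with bounded
   right-hand side. *)
pose cl x := Num.max x0 (Num.min x b).
have clP x : x0 <= cl x <= b.
  by rewrite /cl le_max lexx ge_max (ltW x0b) ge_min lexx orbT.
have clid x : x0 <= x <= b -> cl x = x.
  by move=> /andP[? ?]; rewrite /cl min_l// max_r.
have clq x : `|cl x - q| < r.
  by apply: near_q; have := clP x; lra.
have ccl : continuous cl.
  move=> x; apply: (@continuous_max _ _ (cst x0) (fun x => Num.min x b)).
    exact: cvg_cst.
  by apply: (@continuous_min _ _ id (cst b)); [exact: cvg_id|exact: cvg_cst].
have bq : `|b - q| < r by apply: near_q; rewrite /b; lra.
have x0r : `|x0 - q| < r by apply: near_q; lra.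
have Gle x y : `|x - q| < r -> `|y - q| < r -> x <= y -> G x <= G y.
  by move=> xr yr; rewrite le_eqVlt => /predU1P[->//|xy]; rewrite ltW// Ginc.
have [||th [Th [thK ThK ltTh dth _]]] := @scalar_flow R (G \o cl) (G b).
- by move=> x; apply: continuous_comp; [exact: ccl|exact: cG].
- move=> x; have /andP[x1 x2] := clP x; rewrite /= Gle// andbT -Gq Ginc//.
  exact: lt_le_trans x1.
pose t0 := Th x0; pose T := Th b - t0.
pose phi t : R * R := (th (t + t0), G (th (t + t0))).
have T0 : 0 < T by rewrite subr_gt0 ltTh.
have th_inc x y : x <= y -> th x <= th y.
  move=> xy; rewrite leNgt; apply/negP => /ltTh; rewrite !thK.
  by rewrite ltNge xy.
have th_itv t : 0 <= t <= T -> x0 <= th (t + t0) <= b.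
  move=> /andP[t1 t2]; rewrite -{1}(ThK x0) -(ThK b) !th_inc//.
    by move: t2; rewrite /T /t0; lra.
  by rewrite /t0; lra.
have th_q t : 0 <= t <= T -> `|th (t + t0) - q| < r.
  by move=> /th_itv/clid <-.
have dphi (t : R) : 0 <= t <= T -> is_derive t 1 phi (newton R f (phi t)).
  move=> tT; have tr := th_q t tT; have [_ _ _ GgE _] := Gg _ tr.
  have dtht : is_derive t 1 (fun t => th (t + t0)) (G (th (t + t0))).
    have ds := is_derive_shift t 1 t0.
    have := @is_derive1_comp R th (shift t0) t _ _ (dth (t + t0)) ds.
    by rewrite mulr1 /= clid// th_itv.
  apply/is_derive_pair; rewrite /newton /=; split => //.
  have := is_derive1_comp (dG _ tr) dtht.
  by rewrite mulrC GgE.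
have sphi : solution (@half_plane R) (newton R f) `[0, T] phi.
  split.
  - apply: continuous_in_subspaceT => t /set_mem/=; rewrite in_itv/= => tT.
    exact: is_derive_continuous (dphi t tT).
  - move=> t /=; rewrite in_itv/= => /th_itv; rewrite /half_plane /=; lra.
  - move=> t; rewrite interior_itv_bnd /= in_itv/= => tT.
    by apply: dphi; move: tT; lra.
have phi0 : ball (q, 0) del (phi 0).
  rewrite /phi add0r /t0 ThK; split; rewrite -ball_normE /ball_ //=.
  by rewrite sub0r normrN.
have TT : 0 <= T <= T by rewrite lexx ltW.
have [+ _] := delP T phi sphi phi0 T TT.
rewrite -ball_normE /ball_ /= /T subrK ThK /b.
by rewrite opprD addrA subrr sub0r normrN gtr0_norm ?ltxx.
Unshelve. all: by end_near. Qed.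

(** The linearization is (u, v) -> (v, k u), with eigenvectors (1, l) for the two roots of l^2 =
    k. *)
Lemma saddle_of_derive_gt0 (R : realType) (f : R -> R) (q k : R) : 0 < q ->
  f q = 0 -> is_derive q 1 f k -> 0 < k ->
  saddle (@half_plane R) (newton R f) (q, 0).
Proof.
move=> q0 fq dfq k0.
have df : is_diff q f (fun h => h * k).
  have dq : derivable f q 1 by exact: ex_derive.
  have dfE := deriv1E dq; split; first exact/derivable1_diffP.
  by rewrite dfE derive1E derive_val.
have d1 : is_diff ((q, 0) : R * R) (@fst R R) fst.
  have cfst : continuous (@fst R R) by move=> p; exact: cvg_fst.
  by split; [exact: linear_differentiable|exact: diff_lin].
have d2 : is_diff ((q, 0) : R * R) (@snd R R) snd.
  have csnd : continuous (@snd R R) by move=> p; exact: cvg_snd.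
  by split; [exact: linear_differentiable|exact: diff_lin].
have d3 : is_diff ((q, 0) : R * R) (f \o fst) (fun p => p.1 * k).
  exact: (@is_diff_comp _ _ _ _ _ fst f (fun h => h * k) _ d1 df).
have dn := is_diff_pair d2 d3.
have dnE : 'd (newton R f) (q, 0) = (fun p => (p.2, p.1 * k)) :> (_ -> _).
  exact: diff_val.
split.
- by split => //; rewrite /newton /= fq.
- exact: ex_diff.
have eigen l : l ^+ 2 = k -> 'd (newton R f) (q, 0) (1, l) = l *: (1, l).
  move=> lk; rewrite dnE; apply/pair_equal_spec; split.
    by rewrite /= [RHS]mulr1.
  by rewrite /= mul1r -lk.
have sk : Num.sqrt k ^+ 2 = k by rewrite sqr_sqrtr// ltW.
exists (- Num.sqrt k), (Num.sqrt k), (1, - Num.sqrt k), (1, Num.sqrt k).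
split.
- by rewrite oppr_lt0 sqrtr_gt0 k0.
- by split; [rewrite xpair_eqE oner_eq0|apply: eigen; rewrite sqrrN].
- by split; [rewrite xpair_eqE oner_eq0|exact: eigen].
Qed.

(** * Folds *)

(** Caratheodory's form dh x = s x (x - x0), with s negative near x0, makes h strictly increasing
    before x0 and strictly decreasing after it. Each level slightly below the maximum is thus hit
    exactly once on each side. *)
Lemma fold_level_sets (R : realType) (h dh : R -> R) (x0 c : R) : 0 < x0 ->
  (forall x : R, 0 < x -> is_derive x 1 h (dh x)) ->
  dh x0 = 0 -> is_derive x0 1 dh c -> c < 0 ->
  exists r d : R, [/\ 0 < r < x0, 0 < d,
    forall x, `|x - x0| < r -> x != x0 -> h x < h x0
    & forall e, 0 < e < d -> exists p1 p2 : R,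
      [/\ `|p1 - x0| < r /\ `|p2 - x0| < r, 0 < dh p1, dh p2 < 0
        & forall x, `|x - x0| < r -> (h x = h x0 - e <-> x = p1 \/ x = p2)]].
Proof.
move=> x00 dhE dh0 /is_derive1_caratheodory[s [sE cs sx0]] c0.
have [d1 d10 d1P] : exists2 d1 : R, 0 < d1 &
    forall x, `|x - x0| < d1 -> s x < 0.
  have : \forall x \near x0, s x < 0.
    by apply: (cvgr_lt _ cs); rewrite sx0.
  move=> /nbhs_ballP[d1 /= d10 dP]; exists d1 => // x xd; apply: dP.
  by rewrite -ball_normE /ball_ /= distrC.
pose r := Num.min d1 x0 / 2.
have r0 : 0 < r by rewrite divr_gt0// lt_min d10.
have [rd1 rx0] : r < d1 /\ r < x0.
  have : r < Num.min d1 x0 by move: r0; rewrite /r; lra.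
  by rewrite lt_min => /andP.
have dhl x : x0 - r <= x < x0 -> 0 < dh x.
  move=> xr; have := sE x; rewrite dh0 subr0 => ->.
  rewrite nmulr_rgt0 ?subr_lt0; first by case/andP: xr.
  by apply: d1P; rewrite ltr_norml; lra.
have dhr x : x0 < x <= x0 + r -> dh x < 0.
  move=> xr; have := sE x; rewrite dh0 subr0 => ->.
  rewrite nmulr_rlt0 ?subr_gt0; first by case/andP: xr.
  by apply: d1P; rewrite ltr_norml; lra.
have incl x y : x0 - r <= x -> x < y -> y <= x0 -> h x < h y.
  move=> xr xy yx0; have [|c' cxy hE] := MVT_closed R h dh x y xy.
    by move=> z zxy; apply: dhE; lra.
  by rewrite -subr_gt0 hE mulr_gt0 ?subr_gt0// dhl; lra.
have decr x y : x0 <= x -> x < y -> y <= x0 + r -> h y < h x.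
  move=> xr xy yx0; have [|c' cxy hE] := MVT_closed R h dh x y xy.
    by move=> z zxy; apply: dhE; lra.
  by rewrite -subr_lt0 hE nmulr_rlt0 ?subr_gt0// dhr; lra.
have ch a b : 0 < a -> {within `[a, b], continuous h}.
  move=> a0; apply: derivable_within_continuous => x; rewrite in_itv/= => xab.
  have dx := dhE x ltac:(lra); exact: ex_derive.
(* The smaller of the two drops at the ends: for 0 < e < d the level h x0 - e is strictly between
   the end values and the maximum, so its two preimages avoid x0 and the ends. *)
pose d := Num.min (h x0 - h (x0 - r)) (h x0 - h (x0 + r)).
exists r, d; split.
- by rewrite r0.
- by rewrite lt_min !subr_gt0 incl ?decr//; lra.
- move=> x; rewrite ltr_norml => xr xx0.
  have [xl|xl|xE] := ltgtP x x0; last by rewrite xE eqxx in xx0.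
    by apply: incl; lra.
  by apply: decr; lra.
move=> e /andP[e0]; rewrite lt_min => /andP[e1 e2].
have [|||p1] := @IVT R h (x0 - r) x0 (h x0 - e).
- by lra.
- by apply: ch; lra.
- by rewrite ge_min le_max; apply/andP; split; apply/orP; [left|right]; lra.
rewrite in_itv/= => /andP[p11 p12] p1E.
have [|||p2] := @IVT R h x0 (x0 + r) (h x0 - e).
- by lra.
- by apply: ch; lra.
- by rewrite ge_min le_max; apply/andP; split; apply/orP; [right|left]; lra.
rewrite in_itv/= => /andP[p21 p22] p2E.
have {}p11 : x0 - r < p1.
  by rewrite lt_neqAle p11 andbT; apply/eqP => pE; move: p1E; rewrite -pE; lra.
have {}p12 : p1 < x0.
  by rewrite lt_neqAle p12 andbT; apply/eqP => pE; move: p1E; rewrite pE; lra.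
have {}p21 : x0 < p2.
  by rewrite lt_neqAle p21 andbT; apply/eqP => pE; move: p2E; rewrite -pE; lra.
have {}p22 : p2 < x0 + r.
  by rewrite lt_neqAle p22 andbT; apply/eqP => pE; move: p2E; rewrite pE; lra.
exists p1, p2; split.
- by split; rewrite ltr_norml; lra.
- by apply: dhl; lra.
- by apply: dhr; lra.
move=> x; rewrite ltr_norml => xr; split=> [xE|[->|->]//].
have [xx0|xx0] := leP x x0.
  left; have [l|l|//] := ltgtP x p1.
    by have := incl x p1 ltac:(lra) l ltac:(lra); rewrite p1E xE ltxx.
  by have := incl p1 x ltac:(lra) l ltac:(lra); rewrite p1E xE ltxx.
right; have [l|l|//] := ltgtP x p2.
  by have := decr x p2 ltac:(lra) l ltac:(lra); rewrite p2E xE ltxx.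
by have := decr p2 x ltac:(lra) l ltac:(lra); rewrite p2E xE ltxx.
Qed.

(** * The function m *)

Section model.
Context (R : realType) (b1 b2 : R).

Definition dm (x : R) : R := - (8 * b1) / x ^+ 9 - 1 + 2 * b2 / x ^+ 3.

Definition ddm (x : R) : R := 72 * b1 / x ^+ 10 - 6 * b2 / x ^+ 4.

Definition potential (a x : R) : R :=
  - b1 / 7 / x ^+ 7 - x ^+ 2 / 2 + b2 / x + a * x.

Lemma is_derive_inv_exp (n : nat) (c x : R) : x != 0 ->
  is_derive x 1 (fun y => c / y ^+ n.+1) (- (n.+1%:R * c) / x ^+ n.+2).
Proof.
move=> x0; have xn : (id ^+ n.+1 : R -> R) x != 0 by rewrite !fctE expf_neq0.
have : is_derive x 1 (c *: (fun y => ((id ^+ n.+1 : R -> R) y)^-1))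
    (- (n.+1%:R * c) / x ^+ n.+2); last first.
  by apply: (near_eq_is_derive _); near=> y; rewrite !fctE.
apply: is_derive_eq; rewrite !fctE /GRing.scale /= !exprS.
by field; rewrite x0 expf_neq0.
Unshelve. all: by end_near. Qed.

Lemma is_derive_m (x : R) : 0 < x -> is_derive x 1 (m b1 b2) (dm x).
Proof.
move=> x0; have xn : x != 0 by rewrite gt_eqF.
have d8 := is_derive_inv_exp 7 b1 x xn; have d2 := is_derive_inv_exp 1 b2 x xn.
have : is_derive x 1 ((fun y => b1 / y ^+ 8) - id - (fun y => b2 / y ^+ 2)) (dm x).
  by apply: is_derive_eq; rewrite /dm; ring.
by [].
Qed.

Lemma is_derive_dm (x : R) : 0 < x -> is_derive x 1 dm (ddm x).
Proof.
move=> x0; have xn : x != 0 by rewrite gt_eqF.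
have d9 := is_derive_inv_exp 8 (- (8 * b1)) x xn.
have d3 := is_derive_inv_exp 2 (2 * b2) x xn.
have : is_derive x 1
    ((fun y => - (8 * b1) / y ^+ 9) - cst 1 + (fun y => 2 * b2 / y ^+ 3)) (ddm x).
  by apply: is_derive_eq; rewrite /ddm; ring.
by [].
Qed.

Lemma is_derive_potential (a x : R) : 0 < x ->
  is_derive x 1 (potential a) (F b1 b2 x a).
Proof.
move=> x0; have xn : x != 0 by rewrite gt_eqF.
have d7 := is_derive_inv_exp 6 (- b1 / 7) x xn.
have d1 := is_derive_inv_exp 0 b2 x xn.
have -> : potential a = (fun y => - b1 / 7 / y ^+ 7) - 2^-1 *: (id ^+ 2)
    + (fun y => b2 / y ^+ 1) + a *: id.
  by apply/funext => y; rewrite /potential [_ ^+ 2 / 2]mulrC.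
have d2 : is_derive x 1 (2^-1 *: (id ^+ 2) : R -> R) x.
  by apply: is_derive_eq; rewrite /GRing.scale /= expr1; lra.
have da : is_derive x 1 (a *: id : R -> R) a.
  by apply: is_derive_eq; rewrite /GRing.scale /= mulr1.
apply: (is_derive_eq (is_deriveD (is_deriveD (is_deriveB d7 d2) d1) da)).
by rewrite /F /m; lra.
Qed.

Lemma is_derive_F (a x : R) : 0 < x ->
  is_derive x 1 (fun y => F b1 b2 y a) (dm x).
Proof.
move=> /is_derive_m d.
have : is_derive x 1 (m b1 b2 + cst a) (dm x).
  by apply: is_derive_eq; rewrite addr0.
by [].
Qed.

(** If m'' also vanished, 12 b1 = b2 x^6. Substituting this in m' = 0 gives x^3 = 4 b2 / 3, hence b1
    = 4 b2^3 / 27, the excluded value. *)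
Lemma ddm_neq0 (x : R) : 0 < b2 -> 0 < b1 < b1_star b2 -> 0 < x -> dm x = 0 ->
  ddm x != 0.
Proof.
move=> b20 /andP[b10 b1s] x0 dm0; apply/eqP => ddm0.
have xn : x != 0 by rewrite gt_eqF.
have e1 : 12 * b1 = b2 * x ^+ 6.
  have : ddm x * x ^+ 10 = 0 by rewrite ddm0 mul0r.
  have -> : ddm x * x ^+ 10 = 72 * b1 - 6 * b2 * x ^+ 6 by rewrite /ddm; field.
  lra.
have e2 : 2 * b2 * x ^+ 6 - 8 * b1 = x ^+ 9.
  have : dm x * x ^+ 9 = 0 by rewrite dm0 mul0r.
  have -> : dm x * x ^+ 9 = 2 * b2 * x ^+ 6 - 8 * b1 - x ^+ 9 by rewrite /dm; field.
  lra.
have x6 : x ^+ 6 != 0 by rewrite expf_neq0.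
have e3 : x ^+ 3 = 4 / 3 * b2.
  apply: (mulIf x6); rewrite -exprD -e2; lra.
move: b1s; rewrite /b1_star.
have -> : b1 = 4 / 27 * b2 ^+ 3; last by rewrite ltxx.
have : 12 * b1 = b2 * (4 / 3 * b2) ^+ 2 by rewrite e1 -e3 -exprM.
rewrite exprMn; lra.
Qed.

End model.

(** * First and second order conditions at a local maximum *)

Lemma derive_eq0_of_local_max (R : realType) (h dh : R -> R) (x0 : R) : 0 < x0 ->
  (forall x : R, 0 < x -> is_derive x 1 h (dh x)) ->
  (\forall y \near x0, h y <= h x0) -> dh x0 = 0.
Proof.
move=> x00 dhE /nbhs_ballP[e /= e0 eP].
pose r := Num.min e x0.
have r0 : 0 < r by rewrite lt_min e0.
have in_ball y : y \in `](x0 - r), (x0 + r)[ -> 0 < y /\ h y <= h x0.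
  rewrite in_itv/= => yr; have : `|y - x0| < r by rewrite ltr_norml; lra.
  rewrite lt_min => /andP[ye yx]; split.
    by move: yx; rewrite ltr_norml; lra.
  by apply: eP; rewrite -ball_normE /ball_ /= distrC.
have d0 : is_derive x0 1 h 0.
  apply: (@derive1_at_max R h (x0 - r) (x0 + r)).
  - by lra.
  - by move=> t /in_ball[/dhE dt _]; exact: ex_derive.
  - by rewrite in_itv/=; lra.
  - by move=> t /in_ball[].
have dx := dhE x0 x00.
by rewrite -(@derive_val _ _ _ x0 1 h (dh x0) dx) (@derive_val _ _ _ x0 1 h 0 d0).
Qed.

(** If c were positive, [fold_level_sets] for -h would make x0 a strict local minimum of h, which a
    point slightly to the right of x0 contradicts. *)
Lemma second_derive_lt0_of_local_max (R : realType) (h dh : R -> R) (x0 c : R) :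
  0 < x0 -> (forall x : R, 0 < x -> is_derive x 1 h (dh x)) ->
  (\forall y \near x0, h y <= h x0) -> is_derive x0 1 dh c -> c != 0 -> c < 0.
Proof.
move=> x00 dhE hmax dc; rewrite neq_lt => /orP[//|c0].
have dh0 := derive_eq0_of_local_max R h dh x0 x00 dhE hmax.
have [|||r [_ [/andP[r0 _] _ hlt _]]] :=
  @fold_level_sets R (- h) (- dh) x0 (- c) x00.
- by move=> x /dhE ?; exact: is_deriveN.
- by rewrite fctE dh0 oppr0.
- by rewrite oppr_lt0.
near x0^'+ => x.
have xx0 : x0 < x by [].
have xr : `|x - x0| < r.
  rewrite gtr0_norm ?subr_gt0// ltrBlDl.
  by near: x; apply: nbhs_right_lt; rewrite ltrDl.
have := hlt x xr (negbT (gt_eqF xx0)); rewrite !fctE ltrN2 ltNge => /negP[].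
near: x; exact: (cvg_at_right_filter cvg_id) hmax.
Unshelve. all: by end_near. Qed.

(** * Saddle-node bifurcation at a nondegenerate extremum of m *)

Section model_saddle_node.
Context (R : realType) (b1 b2 : R).

Lemma cvgF (a x : R) : 0 < x -> {for x, continuous (fun y => F b1 b2 y a)}.
Proof. by move=> /(is_derive_F R b1 b2 a); exact: is_derive_continuous. Qed.

Lemma center_of_dm_lt0 (a p : R) :
  0 < p -> F b1 b2 p a = 0 -> dm R b1 b2 p < 0 ->
  stable (@half_plane R) (conservative_system b1 b2 a) (p, 0) /\
  Defs.center (@half_plane R) (conservative_system b1 b2 a) (p, 0).
Proof.
move=> p0 Fp dp; split.
  exact: (@stable_of_derive_lt0 R (potential R b1 b2 a)
    (fun x => F b1 b2 x a) p _ p0 (is_derive_potential R b1 b2 a) (cvgF a) Fp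
    (is_derive_F R b1 b2 a p p0) dp).
exact: (@center_of_derive_lt0 R (potential R b1 b2 a)
  (fun x => F b1 b2 x a) p _ p0 (is_derive_potential R b1 b2 a) (cvgF a) Fp
  (is_derive_F R b1 b2 a p p0) dp).
Qed.

Lemma saddle_of_dm_gt0 (a p : R) :
  0 < p -> F b1 b2 p a = 0 -> 0 < dm R b1 b2 p ->
  unstable (@half_plane R) (conservative_system b1 b2 a) (p, 0) /\
  saddle (@half_plane R) (conservative_system b1 b2 a) (p, 0).
Proof.
move=> p0 Fp dp; split.
  exact: (@unstable_of_derive_gt0 R (potential R b1 b2 a)
    (fun x => F b1 b2 x a) p _ p0 (is_derive_potential R b1 b2 a) (cvgF a) Fp
    (is_derive_F R b1 b2 a p p0) dp).
exact: (@saddle_of_derive_gt0 R (fun x => F b1 b2 x a) p _ p0 Fp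
  (is_derive_F R b1 b2 a p p0) dp).
Qed.

Lemma saddle_node_of_fold (x0 : R) (s : bool) : 0 < x0 -> dm R b1 b2 x0 = 0 ->
  (if s then ddm R b1 b2 x0 < 0 else 0 < ddm R b1 b2 x0) ->
  local_saddle_node (conservative_system b1 b2) x0 (- m b1 b2 x0).
Proof.
move=> x00 dm0 ddm0.
(* Both kinds of extremum are treated together: sgn m has a nondegenerate maximum at [x0]. *)
pose sgn : R := if s then 1 else -1.
have sgn2 : sgn * sgn = 1 by rewrite /sgn; case: s {ddm0 sgn}; ring.
have sgn_inj u v : sgn * u = sgn * v -> u = v.
  by move=> /(congr1 ( *%R sgn)); rewrite !mulrA sgn2 !mul1r.
have [||||r [d [/andP[r0 rx0] d0 hlt hfold]]] := @fold_level_sets R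
    (sgn *: m b1 b2) (sgn *: dm R b1 b2) x0 (sgn * ddm R b1 b2 x0) x00.
- by move=> x /is_derive_m ?; exact: is_deriveZ.
- by rewrite fctE dm0 scaler0.
- by have ? := is_derive_dm R b1 b2 x0 x00; exact: is_deriveZ.
- by rewrite /sgn; case: s ddm0 {sgn sgn2 sgn_inj} => ?; lra.
pose U : set R := [set x | `|x - x0| < r].
have Upos x : U x -> 0 < x by rewrite /U /= ltr_norml; lra.
have equilE a p : equilibria_over (@half_plane R) (conservative_system b1 b2 a) U p <->
    [/\ p.2 = 0, `|p.1 - x0| < r & m b1 b2 p.1 = - a].
  split=> [[[_ [-> Fp]] Up]|[p2 Up mp]].
    by split=> //; move: Fp; rewrite /F; lra.
  split => //; split; first exact: Upos.
  by rewrite /conservative_system p2 /F mp addNr.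
exists U, d, s; split=> //.
- by apply: near_dist_lt; rewrite subrr normr0.
- apply/seteqP; split=> [p /equilE[p2 Up]|_ ->]; last first.
    by apply/equilE; rewrite /= subrr normr0 opprK.
  rewrite opprK => mp; rewrite /= (surjective_pairing p) p2; congr (_, _).
  apply/eqP; apply: contraT => px0.
  by have := hlt _ Up px0; rewrite !fctE mp ltxx.
move=> a /andP[a0 ad].
(* The signed parameter distance sgn (a - a0) is the depth of the level m = -a below the maximum of
   sgn m: two equilibria for e > 0, none for e < 0. *)
pose e := sgn * (a + m b1 b2 x0).
have ee : `|e| = `|a - - m b1 b2 x0|.
  by rewrite normrM opprK /sgn; case: (s); rewrite ?normrN normr1 mul1r.
have es : ((- m b1 b2 x0 < a) == s) = (0 < e).
  move: a0; rewrite normr_gt0 /e /sgn opprK; case: (s) => a0.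
    by rewrite mul1r eqb_id; apply/idP/idP; lra.
  rewrite mulN1r oppr_gt0 eqbF_neg -leNgt le_eqVlt -(inj_eq (addIr (m b1 b2 x0))).
  by rewrite addNr (negbTE a0)/=; apply/idP/idP; lra.
have levelE x : m b1 b2 x = - a <-> (sgn *: m b1 b2) x = (sgn *: m b1 b2) x0 - e.
  rewrite !fctE /GRing.scale /= /e; split=> [->|]; first by ring.
  by move=> sE; apply: sgn_inj; rewrite sE; ring.
rewrite es; case: ifPn => [e0|].
  have [|p1 [p2 [[p1U p2U] dp1 dp2 pE]]] := hfold e.
    by rewrite e0 -ee ger0_norm ?ltW// in ad *.
  have m1 : m b1 b2 p1 = - a by apply/levelE/pE => //; left.
  have m2 : m b1 b2 p2 = - a by apply/levelE/pE => //; right.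
  have F1 : F b1 b2 p1 a = 0 by rewrite /F m1 addNr.
  have F2 : F b1 b2 p2 a = 0 by rewrite /F m2 addNr.
  have p12 : p1 <> p2 by move=> p12; move: dp1; rewrite p12; lra.
  have eqU : equilibria_over (@half_plane R) (conservative_system b1 b2 a) U
      = [set (p1, 0); (p2, 0)].
    apply/seteqP; split=> [[x y] /equilE[/= -> Up /levelE/(pE _ Up)]|].
      by case=> ->; [left|right].
    by move=> _ [->|->]; apply/equilE.
  (* At [p1] sgn m increases and at [p2] it decreases, so [p2] is the center at a maximum of m and
     [p1] at a minimum. *)
  move: dp1 dp2; rewrite !fctE /GRing.scale /= /sgn.
  case: (s) => dp1 dp2.
    exists (p2, 0), (p1, 0); split.
    + by case=> /esym.
    + by rewrite eqU setUC.
    + by apply: center_of_dm_lt0; [exact: Upos| |lra].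
    + by apply: saddle_of_dm_gt0; [exact: Upos| |lra].
  exists (p1, 0), (p2, 0); split.
  + by case.
  + by [].
  + by apply: center_of_dm_lt0; [exact: Upos| |lra].
  + by apply: saddle_of_dm_gt0; [exact: Upos| |lra].
rewrite -leNgt => e0; rewrite -subset0 => p /equilE[_ Up /levelE hp].
have {}e0 : e < 0.
  by rewrite lt_neqAle e0 andbT -normr_eq0 ee gt_eqF.
have [px|px] := eqVneq p.1 x0; first by move: hp; rewrite px; lra.
by have := hlt _ Up px; rewrite hp; lra.
Qed.

End model_saddle_node.

Theorem theorem2 (R : realType) (b1 b2 : R)
    (hb2 : 0 < b2) (hb1 : 0 < b1 < b1_star b2)
    (xl xr : R)
    (hl : local_min_point [set x | 0 < x] (m b1 b2) xl)
    (hr : local_max_point [set x | 0 < x] (m b1 b2) xr) :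
  local_saddle_node (conservative_system b1 b2) xr (- m b1 b2 xr) /\
  local_saddle_node (conservative_system b1 b2) xl (- m b1 b2 xl).
Proof.
(* The half-line is open, so neighbourhoods relative to it are ordinary ones. *)
have near_pos (x0 : R) (P : R -> Prop) : 0 < x0 ->
    (\forall y \near within [set x | 0 < x] (nbhs x0), P y) ->
    \forall y \near x0, P y.
  by move=> x00; rewrite near_withinE; apply: filterS2 (lt_nbhsr x00) => y y0; exact.
have ddm_neq0 := ddm_neq0 R b1 b2.
split.
- case: hr => xr0 /(near_pos _ _ xr0) hmax.
  have dm0 := derive_eq0_of_local_max R _ _ xr xr0 (is_derive_m R b1 b2) hmax.
  apply: (saddle_node_of_fold R b1 b2 xr true) => //.
  exact: (second_derive_lt0_of_local_max R _ _ xr _ xr0 (is_derive_m R b1 b2) hmax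
    (is_derive_dm R b1 b2 xr xr0) (ddm_neq0 _ hb2 hb1 xr0 dm0)).
- case: hl => xl0 /(near_pos _ _ xl0) hmin.
  (* The minimum of m is handled as a maximum of -m. *)
  have dN (x : R) : 0 < x -> is_derive x 1 (- m b1 b2) (- dm R b1 b2 x).
    by move=> /is_derive_m ?; exact: is_deriveN.
  have hmax : \forall y \near xl, (- m b1 b2) y <= (- m b1 b2) xl.
    by apply: filterS hmin => y; rewrite !fctE lerN2.
  have dm0 : dm R b1 b2 xl = 0.
    apply/eqP; rewrite -oppr_eq0; apply/eqP.
    exact: (derive_eq0_of_local_max R _ (- dm R b1 b2) xl xl0 dN hmax).
  apply: (saddle_node_of_fold R b1 b2 xl false) => //.
  have ddN : is_derive xl 1 (- dm R b1 b2) (- ddm R b1 b2 xl).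
    by have ? := is_derive_dm R b1 b2 xl xl0; exact: is_deriveN.
  rewrite -oppr_lt0.
  apply: (second_derive_lt0_of_local_max R _ _ xl _ xl0 dN hmax ddN).
  by rewrite oppr_eq0; exact: ddm_neq0.
Qed.
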